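(* Let $n\ge 1$. The set of type 4 signed arc permutations, $$\bigcup_{1\le k<l<n}\{\,-k\;\,-(k-1)\;\dots\;-1\;\,-n\;\dots\;-(l+1)\ \sqcup\!\sqcup\ k+1\;\dots\;l\,\}\subset B_n,$$ is in descent preserving bijection with the set of all standard domino tableaux of shapes $(a,2n-a-2,1,1)$, where $a$ ranges over the integers with $a\ge 2n-a-2\ge 2$.
   Context: $B_n$ is the hyperoctahedral group of all permutations $\pi$ of $\{-n,\dots,-1,0,1,\dots,n\}$ with $\pi(-i)=-\pi(i)$ for all $i$; $\pi$ is identified with the word $\pi(1)\cdots\pi(n)$. For $\pi\in B_n$, $Des(\pi)=\{0\le i\le n-1 \mid \pi(i)>\pi(i+1)\}$ (with $\pi(0)=0$). For two sequences $\alpha,\beta$, $\alpha\sqcup\!\sqcup\beta$ is the set of all sequences obtained by interleaving the letters of $\alpha$ and $\beta$ preserving the order of the letters of $\alpha$ and of $\beta$. Young diagrams are drawn with left-justified rows, row 1 on top. A standard domino tableau of shape $\lambda$, $\lambda$ a partition of $2n$, is a tiling of the Young diagram of $\lambda$ by $n$ dominoes ($1\times 2$ or $2\times 1$ rectangles) labelled bijectively by $\{1,\dots,n\}$, labels strictly increasing along rows and down columns (comparing distinct dominoes). A standard domino tableau $T$ has a descent in position $i$, $1\le i\le n-1$, if the domino labelled $i+1$ lies strictly below the domino labelled $i$ (all boxes of domino $i+1$ lie in rows strictly lower than all boxes of domino $i$), and has a descent in position $0$ if the domino labelled $1$ is vertical; $Des(T)$ is the set of its descents. A bijection $f$ from a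 set of signed permutations to a set of standard domino tableaux is descent preserving if $Des(f(\pi))=Des(\pi)$ for all $\pi$. *)

(* Defs.v *)
From mathcomp Require Import all_boot all_order all_fingroup all_algebra.

Set Implicit Arguments.
Unset Strict Implicit.
Unset Printing Implicit Defensive.

Import Order.TTheory GRing.Theory Num.Theory.

(* An element x of 'I_(n.*2.+1) stands for the integer x - n, so the whole    *)
(* type stands for {-n, ..., n} and rev_ord is the negation.                  *)
Definition hyperoctahedral (n : nat) : {set {perm 'I_(n.*2.+1)}} :=
  [set p : {perm 'I_(n.*2.+1)} | [forall x, p (rev_ord x) == rev_ord (p x)]].

(* The integer p(i); only meant for i <= n, where inord is exact. *)
Definition sval_at (n : nat) (p : {perm 'I_(n.*2.+1)}) (i : nat) : int :=
  ((p (inord (n + i)) : nat)%:Z - n%:Z)%R.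

Definition sword (n : nat) (p : {perm 'I_(n.*2.+1)}) : seq int :=
  [seq sval_at p i | i <- iota 1 n].

Definition sperm_Des (n : nat) (p : {perm 'I_(n.*2.+1)}) : {set 'I_n} :=
  [set i : 'I_n | (sval_at p i.+1 < sval_at p i)%R].

(* The mask m marks the positions of w that are occupied by letters of s. *)
Definition is_shuffle (T : eqType) (s t w : seq T) : bool :=
  [exists m : (size w).-tuple bool,
    (mask m w == s) && (mask (map negb m) w == t)].

(* -k, -(k-1), ..., -1, -n, ..., -(l+1) *)
Definition neg_letters (n k l : nat) : seq int :=
  [seq (- i%:Z)%R | i <- rev (iota 1 k) ++ rev (iota l.+1 (n - l))].

(* k+1, ..., l *)
Definition pos_letters (k l : nat) : seq int :=
  [seq Posz i | i <- iota k.+1 (l - k)].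

Definition type4_signed_arc (n : nat) : {set {perm 'I_(n.*2.+1)}} :=
  \bigcup_(l < n) \bigcup_(k < l | 1 <= k)
    [set p in hyperoctahedral n
    | is_shuffle (neg_letters n k l) (pos_letters k l) (sword p)].

(* Boxes are pairs (row, column), both numbered from 0; every partition of    *)
(* 2n fits into this grid.                                                    *)
Definition box (n : nat) : finType := ('I_n.*2 * 'I_n.*2)%type.

Definition young_diagram (n : nat) (lam : seq nat) : {set box n} :=
  [set x : box n | x.2 < nth 0 lam x.1].

Definition is_horizontal (n : nat) (D : {set box n}) : bool :=
  [exists x : box n, exists y : box n,
    [&& D == [set x; y], x.1 == y.1 & x.2.+1 == y.2 :> nat]].

Definition is_vertical (n : nat) (D : {set box n}) : bool :=
  [exists x : box n, exists y : box n,
    [&& D == [set x; y], x.1.+1 == y.1 :> nat & x.2 == y.2]].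

(* T i is the domino labelled i + 1. *)
Definition is_domino_tiling (n : nat) (lam : seq nat)
    (T : {ffun 'I_n -> {set box n}}) : bool :=
  [&& [forall i, is_horizontal (T i) || is_vertical (T i)],
      [forall i, forall j, (i != j) ==> [disjoint T i & T j]]
    & \bigcup_i T i == young_diagram n lam].

Definition labels_increasing (n : nat)
    (T : {ffun 'I_n -> {set box n}}) : bool :=
  [forall i, forall j, forall x in T i, forall y in T j,
    [&& i != j
      & ((x.1 == y.1) && (x.2 < y.2)) || ((x.2 == y.2) && (x.1 < y.1))]
    ==> (i < j)].

Definition standard_domino_tableaux (n : nat) (lam : seq nat) :
    {set {ffun 'I_n -> {set box n}}} :=
  [set T : {ffun 'I_n -> {set box n}}
  | is_domino_tiling lam T && labels_increasing T].

Definition strictly_below (n : nat) (E D : {set box n}) : bool :=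
  [forall x in D, forall y in E, x.1 < y.1].

(* With labels shifted by one, a descent at a position i >= 1 compares T j,   *)
(* j = i - 1, with T i.                                                       *)
Definition domino_Des (n : nat) (T : {ffun 'I_n -> {set box n}}) :
    {set 'I_n} :=
  [set i : 'I_n | ((i == 0 :> nat) && is_vertical (T i))
    || [exists j : 'I_n, (j.+1 == i) && strictly_below (T i) (T j)]].

(* Main.v *)
Require Import Defs.
From mathcomp Require Import all_boot all_order all_fingroup all_algebra.
From mathcomp Require Import zify.

(* A type 4 permutation is determined by the word recording, for each letter, *)
(* whether it is positive, equal to -n, or another negative letter; the words *)
(* that occur are those with one -n, a negative letter before it, and a       *)
(* positive letter. A tableau of shape (a, b, 1, 1) is determined by the      *)
(* word recording whether each domino is the vertical one at the bottom       *)
(* (which plays the role of -n), lies in the first row (positive letter), or  *)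
(* meets the second row (negative letter). Descents can be read off the word  *)
(* in the same way on both sides. The words of tableaux satisfy the same      *)
(* conditions, except that "no positive letter" is replaced by b <= 1 as the  *)
(* forbidden case. These exceptional words are, apart from the -n, of the     *)
(* form "- - ... -" and "- + ... +"; both have descents only at 0 and just    *)
(* before the -n, so exchanging the two families gives the bijection.         *)

Set Implicit Arguments.
Unset Strict Implicit.
Unset Printing Implicit Defensive.

Import Order.TTheory GRing.Theory Num.Theory.

(** The bijection is [tab n (exchange (perm_word p))]. In a type 4 permutation the negative letters
    and the positive letters each come in a prescribed order, so only the parameters and the
    interleaving matter. The word gives both: [k] counts the negative letters before -n, and [l - k]
    counts the positive letters. Thus [1 <= k] puts a negative letter before -n, and [k < l] asks
    for a positive letter ([sword_valid], [sword_inj], [exists_sword]).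

    A tableau is built by adding dominoes in the order of their labels. The boxes of rows three and
    four form one vertical domino, which can be added once the second row is nonempty. The other
    dominoes fill two rows whose lengths differ by an even number, so at each stage one domino fits
    in the first row and at most one can meet the second ([next_cells], [standard_step]). Hence the
    word determines the tableau ([standard_tab]), and every valid word yields one ([tab_standard]).

    On both sides [desw] computes the descents ([sperm_Des_word], [domino_Des_tab]). The two sets of
    words differ only in the excluded family ([has_plus], [rows1_gt1]); the involution [exchange]
    swaps these families and preserves [desw] ([desw_exchange]). *)

(** * Words *)

(* [Some true] and [Some false] are the signs of a positive and a negative    *)
(* letter; [None] is the letter -n.                                           *)
Definition word := seq (option bool).

Definition valid_word (u : word) : bool :=
  (count_mem None u == 1) && (index (Some false) u < index None u).

(** Entry [i], counted from 0, is the letter in position [i + 1] or the domino labelled [i + 1], so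
    this is a descent at position [i]. The case [i == 0] reflects the value 0 in front of the
    permutation and a vertical first domino. *)
Definition desw (u : word) (i : nat) : bool :=
  (nth None u i == None) || (nth None u i == Some false) &&
  ((i == 0) || (nth None u i.-1 == Some true)).

(* [no_later false] and [no_later true] single out the words of the form  *)
(* "- + ... +" and "- - ... -", up to the position of [None].                 *)
Definition no_later (b : bool) (u : word) : bool :=
  (head None u == Some false) && (Some b \notin behead u).

(** [omap negb] fixes [None], so -n keeps its place. The head is spared so that an initial negative
    letter, and with it validity and the descent at 0, survives. *)
Definition flip_tail (u : word) : word :=
  if u is c :: v then c :: map (omap negb) v else u.

Definition exchange (u : word) : word :=
  if no_later false u || no_later true u then flip_tail u else u.

(* A state (r0, r1, r2) is the shape (r0, r1, r2, r2). Since r0 - r1 stays    *)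
(* even, a negative letter has exactly one possible domino: a vertical one if *)
(* r0 = r1, and a horizontal one in the second row otherwise.                 *)
Definition step (s : nat * nat * nat) (c : option bool) : nat * nat * nat :=
  let: (r0, r1, r2) := s in
  match c with
  | None => (r0, r1, r2.+1)
  | Some true => (r0.+2, r1, r2)
  | Some false => if r0 == r1 then (r0.+1, r1.+1, r2) else (r0, r1.+2, r2)
  end.

Definition rows (u : word) : nat * nat * nat := foldl step (0, 0, 0) u.

Lemma rows_rcons (u : word) (c : option bool) :
  rows (rcons u c) = step (rows u) c.
Proof. by rewrite /rows foldl_rcons. Qed.

(** Parity justifies the choice made in [step]: rows of different lengths differ by at least 2,
    which leaves room for a horizontal domino in the second row. *)
Lemma rows_inv (u : word) :
  [/\ (rows u).1.2 <= (rows u).1.1,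
      ~~ odd ((rows u).1.1 - (rows u).1.2),
      (rows u).1.1 + (rows u).1.2 = (size u - count_mem None u).*2,
      (rows u).2 = count_mem None u
    & (0 < (rows u).1.2) = (Some false \in u)].
Proof.
elim/last_ind: u => [|u c [le10 ev sz r2 pos]]; first by [].
have csz := count_size (pred1 None) u.
rewrite -r2 in sz csz.
rewrite rows_rcons mem_rcons in_cons -cats1 count_cat size_cat -pos -r2 /=.
move: le10 ev sz csz {r2 pos}; case: (rows u) => [[r0 r1] r2'] /= le10 ev sz csz.
case: c => [[]|] /=; last by split=> //; lia.
  by split=> //; lia.
by case: eqP => [e|ne] /=; split=> //; lia.
Qed.

(** The form in which validity meets tableaux: when the bottom domino is added, rows three and four
    are empty and the second row is not. *)
Lemma valid_word_None (u : word) (i : nat) : valid_word u -> i < size u ->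
  nth None u i = None -> (None \notin take i u) && (Some false \in take i u).
Proof.
case/andP=> /eqP c1 lt isz ni.
have E : u = take i u ++ None :: drop i.+1 u.
  by rewrite -{1}(cat_take_drop i u) (drop_nth None isz) ni.
have nt : None \notin take i u.
  move: c1; rewrite {1}E count_cat /= => c1; apply/count_memPn.
  by move: c1; case: (count _ _) => // k; rewrite add1n addnS.
rewrite nt /=; case: (boolP (Some false \in take i u)) => // nf.
move: lt; rewrite {1 2}E !index_cat (negbTE nt) (negbTE nf) /=; lia.
Qed.

Lemma valid_wordI (u : word) : None \in u ->
  (forall i, i < size u -> nth None u i = None ->
    (None \notin take i u) && (Some false \in take i u)) -> valid_word u.
Proof.
move=> nu H; have isz : index None u < size u by rewrite index_mem.
have ni : nth None u (index None u) = None by rewrite nth_index.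
have /andP[nt ft] := H _ isz ni.
move: isz ni nt ft; set i := index None u => isz ni nt ft.
have E : u = take i u ++ None :: drop i.+1 u.
  by rewrite -{1}(cat_take_drop i u) (drop_nth None isz) ni.
have nd : None \notin drop i.+1 u.
  apply/negP=> /(nthP None)[j]; rewrite size_drop nth_drop ltn_subRL => jlt nj.
  have /andP[/negP[]] := H (i.+1 + j) jlt nj.
  apply/(nthP None); exists i; last by rewrite nth_take // leq_addr.
  by rewrite size_take; case: ifP => // _; rewrite leq_addr.
apply/andP; split.
  by rewrite E count_cat /= (count_memPn nt) (count_memPn nd).
rewrite -/i {1}E index_cat ft.
by apply: (@leq_trans (size (take i u))); rewrite ?index_mem // size_take isz.
Qed.

(** * The length of the second row *)

Lemma rows1_mono (u : word) (s : nat * nat * nat) :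
  s.1.2 + count_mem (Some false) u <= (foldl step s u).1.2.
Proof.
elim: u s => [|c u IH] [[r0 r1] r2] /=; first by rewrite addn0.
apply: leq_trans (IH _).
by case: c => [[]|] /=; try lia; case: eqP => /=; lia.
Qed.

(** The rows differ until the first negative letter, whose domino is therefore horizontal and puts
    two boxes in the second row at once. *)
Lemma rows1_big (u : word) (s : nat * nat * nat) : 1 < s.1.1 -> s.1.2 = 0 ->
  Some false \in u -> 1 < (foldl step s u).1.2.
Proof.
elim: u s => [|c u IH] [[r0 r1] r2] //= gt0 ->.
case: c => [[]|] /=; try by rewrite inE /=; apply: IH => //=; lia.
move=> _; have -> : (r0 == 0) = false by lia.
exact: leq_trans (rows1_mono u (r0, 2, r2)).
Qed.

Lemma rows1_const (u : word) (s : nat * nat * nat) : Some false \notin u ->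
  (foldl step s u).1.2 = s.1.2.
Proof.
elim: u s => [|c u IH] [[r0 r1] r2] //=; rewrite inE negb_or => /andP[nc nu].
by rewrite IH //; case: c nc => [[]|].
Qed.

(** A single box in the second row comes from a vertical domino, which must be placed first; any
    later negative letter would lengthen that row. *)
Lemma rows1_gt1 (u : word) : valid_word u ->
  (1 < (rows u).1.2) = ~~ no_later false u.
Proof.
case: u => [|c u] //; rewrite /no_later /rows /= => /andP[_].
case: c => [[]|] //=.
  case: (boolP (Some false \in u)) => [fu _|]; first by rewrite rows1_big.
  by move=> /memNindex ->; rewrite ltnS ltnNge index_size.
case: (boolP (Some false \in u)) => [fu _|nfu _]; last by rewrite rows1_const.
by apply: leq_trans (rows1_mono _ _); rewrite /= addSn ltnS -has_count has_pred1.
Qed.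

Lemma has_plus (u : word) : valid_word u ->
  (Some true \in u) = ~~ no_later true u.
Proof.
case: u => [|c u] //; rewrite /no_later /= => /andP[_].
by case: c => [[]|] //=; rewrite inE negbK.
Qed.

(** * The exchange of the two exceptional families *)

Lemma omap_negbK : involutive (omap negb).
Proof. by case=> [[]|]. Qed.

Lemma mem_omap_negb (b : bool) (u : word) :
  (Some b \in map (omap negb) u) = (Some (~~ b) \in u).
Proof. by rewrite -(mem_map (can_inj omap_negbK) u) /= negbK. Qed.

Lemma no_later_flip (b : bool) (u : word) :
  no_later b (flip_tail u) = no_later (~~ b) u.
Proof. by case: u => //= c u; rewrite /no_later /= mem_omap_negb. Qed.

Lemma flip_tailK : involutive flip_tail.
Proof. by case=> //= c u; rewrite mapK //; apply: omap_negbK. Qed.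

(** Flipping the tail swaps the two exceptional families, so the test in [exchange] has the same
    outcome afterwards. *)
Lemma exchangeK : involutive exchange.
Proof.
move=> u; rewrite /exchange.
case E: (no_later false u || no_later true u); last by rewrite E.
by rewrite !no_later_flip /= orbC E flip_tailK.
Qed.

Lemma size_exchange (u : word) : size (exchange u) = size u.
Proof. by rewrite /exchange; case: ifP => // _; case: u => //= c u; rewrite size_map. Qed.

Lemma valid_exchange (u : word) : valid_word u -> valid_word (exchange u).
Proof.
rewrite /exchange; case: ifP => // E /andP[c1 _].
have : head None u == Some false by case/orP: E => /andP[].
case: u c1 {E} => //= c u c1 /eqP E; rewrite E /= in c1 *.
rewrite /valid_word /= count_map andbT -(eqP c1) add0n; apply/eqP/eq_count.
by case=> [[]|].
Qed.

Lemma exchange_no_later (b : bool) (u : word) :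
  ~~ no_later b u -> ~~ no_later (~~ b) (exchange u).
Proof.
move=> nb; rewrite /exchange; case: ifP => E.
  by rewrite no_later_flip negbK.
by move: E nb; case: b => /= /norP[].
Qed.

(** After the head there is either no negative letter, or no positive letter for a negative one to
    follow. *)
Lemma desw_no_later (b : bool) (u : word) (i : nat) : i < size u ->
  no_later b u -> desw u i = (i == 0) || (nth None u i == None).
Proof.
case: u i => [|c u] [|i] //= isz /andP[/= /eqP-> nb] //.
rewrite /desw /=; case: (nth None u i =P Some false) => [E|_]; last by rewrite orbF.
have uf : Some false \in u by rewrite -E mem_nth.
have nbt : b by case: b nb; rewrite ?uf.
rewrite E; case: i isz {E} => [|i] isz //=; apply/negP=> /eqP E.
by move: nb; rewrite nbt -E mem_nth //; apply: ltnW.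
Qed.

Lemma desw_exchange (u : word) (i : nat) : i < size u ->
  desw (exchange u) i = desw u i.
Proof.
rewrite /exchange; case: ifP => // /orP E isz.
have [b nb] : exists b, no_later b u by case: E; [exists false | exists true].
have nfb : no_later (~~ b) (flip_tail u) by rewrite no_later_flip negbK.
have szf : size (flip_tail u) = size u by case: u {isz E nb nfb} => //= c u; rewrite size_map.
rewrite (desw_no_later isz nb) (desw_no_later (b := ~~ b)) ?szf //.
case: u i isz {E nb nfb szf} => //= c u [|i] //= isz.
by rewrite (nth_map None) //; case: nth.
Qed.

(** * Tableaux *)

(** Plain numbers as coordinates reduce statements about dominoes to arithmetic. Pairs outside the
    grid are silently dropped, so [in_grid] is what allows the list to be read back from the set. *)
Definition bset (n : nat) (ds : seq (nat * nat)) : {set box n} :=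
  [set x : box n | (val x.1, val x.2) \in ds].

Definition in_grid (n : nat) (ds : seq (nat * nat)) : bool :=
  all (fun d => (d.1 < n.*2) && (d.2 < n.*2)) ds.

Definition cells (s : nat * nat * nat) (c : option bool) : seq (nat * nat) :=
  let: (r0, r1, r2) := s in
  match c with
  | None => [:: (2, r2); (3, r2)]
  | Some true => [:: (0, r0); (0, r0.+1)]
  | Some false =>
      if r0 == r1 then [:: (0, r0); (1, r0)] else [:: (1, r1); (1, r1.+1)]
  end.

Definition shape4 (s : nat * nat * nat) : seq nat :=
  [:: s.1.1; s.1.2; s.2; s.2].

Definition tab (n : nat) (u : word) : {ffun 'I_n -> {set box n}} :=
  [ffun i : 'I_n => bset n (cells (rows (take i u)) (nth None u i))].

Definition domino_letter (n : nat) (D : {set box n}) : option bool :=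
  if [exists x in D, 1 < val x.1] then None
  else Some [forall x in D, val x.1 == 0].

Definition tab_word (n : nat) (T : {ffun 'I_n -> {set box n}}) : word :=
  [seq domino_letter (T i) | i <- enum 'I_n].

Lemma in_young (n : nat) (lam : seq nat) (x : box n) :
  (x \in young_diagram n lam) = (val x.2 < nth 0 lam (val x.1)).
Proof. by rewrite inE. Qed.

Lemma in_bset (n : nat) (ds : seq (nat * nat)) (x : box n) :
  (x \in bset n ds) = ((val x.1, val x.2) \in ds).
Proof. by rewrite inE. Qed.

Lemma young_step (n : nat) (s : nat * nat * nat) (c : option bool) :
  young_diagram n (shape4 (step s c)) =
  young_diagram n (shape4 s) :|: bset n (cells s c).
Proof.
apply/setP=> -[i j]; rewrite in_setU !in_young in_bset /=.
case: i j => i _ [j _] /=; case: s => [[r0 r1] r2].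
case: c => [[]|]; rewrite /step /cells.
- by case: i => [|[|[|[|i]]]]; rewrite !inE !xpair_eqE /=; lia.
- case: eqP => [->|ne];
    by case: i => [|[|[|[|i]]]]; rewrite !inE !xpair_eqE /=; lia.
by case: i => [|[|[|[|i]]]]; rewrite !inE !xpair_eqE /=; lia.
Qed.

Lemma cells_disjoint (n : nat) (s : nat * nat * nat) (c : option bool) :
  [disjoint bset n (cells s c) & young_diagram n (shape4 s)].
Proof.
rewrite disjoints_subset; apply/subsetP=> -[[i hi] [j hj]].
rewrite in_bset in_setC in_young /=; case: s => [[r0 r1] r2].
case: c => [[]|]; rewrite /cells.
- by case: i hi => [|[|[|[|i]]]] hi; rewrite !inE !xpair_eqE /=; lia.
- by case: eqP => e;
    case: i hi => [|[|[|[|i]]]] hi; rewrite !inE !xpair_eqE /=; lia.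
by case: i hi => [|[|[|[|i]]]] hi; rewrite !inE !xpair_eqE /=; lia.
Qed.

Lemma exists_bset (P : nat -> nat -> bool) (n : nat) (ds : seq (nat * nat)) :
  in_grid n ds ->
  [exists x in bset n ds, P (val x.1) (val x.2)] = has (fun d => P d.1 d.2) ds.
Proof.
move=> /allP gr; apply/existsP/hasP => [[x]|[[r c] dd pd]].
  by rewrite in_bset => /andP[xd px]; exists (val x.1, val x.2).
have /andP[hr hc] := gr _ dd.
by exists (Ordinal hr, Ordinal hc); rewrite in_bset /= dd.
Qed.

Lemma forall_bset (P : nat -> nat -> bool) (n : nat) (ds : seq (nat * nat)) :
  in_grid n ds ->
  [forall x in bset n ds, P (val x.1) (val x.2)] = all (fun d => P d.1 d.2) ds.
Proof.
move=> /allP gr; apply/forallP/allP => [H [r c] dd|H x].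
  have /andP[hr hc] := gr _ dd.
  by have := H (Ordinal hr, Ordinal hc); rewrite in_bset /= dd.
by apply/implyP; rewrite in_bset => /H.
Qed.

Lemma bset_inj (n : nat) (ds es : seq (nat * nat)) : in_grid n ds ->
  bset n ds = bset n es -> {subset ds <= es}.
Proof.
move=> /allP gr E [r c] dd; have /andP[hr hc] := gr _ dd.
by have := in_bset es (Ordinal hr, Ordinal hc); rewrite -E in_bset /= dd => <-.
Qed.

Lemma horizontalP (n : nat) (D : {set box n}) :
  reflect (exists r c, in_grid n [:: (r, c); (r, c.+1)] /\
                       D = bset n [:: (r, c); (r, c.+1)])
          (is_horizontal D).
Proof.
apply: (iffP existsP) => [[[x1 x2] /existsP[[y1 y2]]]|[r [c [gr ->]]]] /=.
  case/and3P=> /eqP-> /eqP <- /eqP e; exists x1, x2; split.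
    by rewrite /in_grid /= !ltn_ord /= e !ltn_ord.
  by apply/setP=> -[i j]; rewrite in_bset !inE !xpair_eqE e.
move: gr; rewrite /in_grid /= => /and3P[/andP[hr hc] /andP[_ hc'] _].
exists (Ordinal hr, Ordinal hc); apply/existsP; exists (Ordinal hr, Ordinal hc').
rewrite /= !eqxx !andbT.
by apply/eqP/setP=> -[i j]; rewrite in_bset !inE !xpair_eqE.
Qed.

Lemma verticalP (n : nat) (D : {set box n}) :
  reflect (exists r c, in_grid n [:: (r, c); (r.+1, c)] /\
                       D = bset n [:: (r, c); (r.+1, c)])
          (is_vertical D).
Proof.
apply: (iffP existsP) => [[[x1 x2] /existsP[[y1 y2]]]|[r [c [gr ->]]]] /=.
  case/and3P=> /eqP-> /eqP e /eqP <-; exists x1, x2; split.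
    by rewrite /in_grid /= !ltn_ord /= e !ltn_ord.
  by apply/setP=> -[i j]; rewrite in_bset !inE !xpair_eqE e.
move: gr; rewrite /in_grid /= => /and3P[/andP[hr hc] /andP[hr' _] _].
exists (Ordinal hr, Ordinal hc); apply/existsP; exists (Ordinal hr', Ordinal hc).
rewrite /= !eqxx !andbT.
by apply/eqP/setP=> -[i j]; rewrite in_bset !inE !xpair_eqE.
Qed.

(** Two boxes per earlier letter bound the columns. The bottom domino needs four rows, hence
    [2 <= size u], which the negative letter before it provides. *)
Lemma cells_in_grid (u : word) (i : nat) : valid_word u -> i < size u ->
  in_grid (size u) (cells (rows (take i u)) (nth None u i)).
Proof.
move=> vu isz; have [le10 ev sz r2 pos] := rows_inv (take i u).
have szt : size (take i u) = i by rewrite size_takel // ltnW.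
rewrite szt in sz; have V := valid_word_None vu isz.
case E : (nth None u i) V => [[]|] V; move: sz le10 ev r2 pos;
  case: (rows _) => [[r0 r1] r2'] /= sz le10 ev r2 pos; rewrite /in_grid.
- by rewrite /=; lia.
- by case: eqP => [e|ne] /=; lia.
have /andP[nN fN] := V erefl.
have i1 : 0 < i by rewrite -szt; case: (take i u) fN.
by rewrite /= r2 (count_memPn nN); lia.
Qed.

Lemma domino_letter_cells (n : nat) (s : nat * nat * nat) (c : option bool) :
  in_grid n (cells s c) -> domino_letter (bset n (cells s c)) = c.
Proof.
move=> gr; rewrite /domino_letter (exists_bset (fun r _ => 1 < r)) //.
rewrite (forall_bset (fun r _ => r == 0)) //.
by case: s c {gr} => [[r0 r1] r2] [[]|] //=; case: eqP.
Qed.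

Lemma tab_wordK (u : word) : valid_word u -> tab_word (tab (size u) u) = u.
Proof.
move=> vu; apply: (@eq_from_nth _ None) => [|i]; rewrite size_map size_enum_ord //.
move=> isz; rewrite (nth_map (Ordinal isz)) ?size_enum_ord //.
have -> : nth (Ordinal isz) (enum 'I_(size u)) i = Ordinal isz.
  by apply: val_inj; rewrite /= nth_enum_ord.
by rewrite ffunE domino_letter_cells //= cells_in_grid.
Qed.

Lemma rows_take (u : word) (i : nat) : i < size u ->
  rows (take i.+1 u) = step (rows (take i u)) (nth None u i).
Proof. by move=> isz; rewrite (take_nth None) // rows_rcons. Qed.

Lemma is_vertical_bset (n : nat) (d e : nat * nat) :
  in_grid n [:: d; e] -> is_vertical (bset n [:: d; e]) -> d.1 != e.1.
Proof.
move=> gr /verticalP[r [c [gr' E]]]; apply/eqP=> e1.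
have := bset_inj gr' (esym E); case: d e {gr gr' E} e1 => [d1 d2] [e3 e4] /= -> sub.
have := sub (r, c); have := sub (r.+1, c).
rewrite !inE !xpair_eqE !eqxx /= orbT => /(_ isT) + /(_ isT); lia.
Qed.

Lemma strictly_below_bset (n : nat) (ds es : seq (nat * nat)) :
  in_grid n ds -> in_grid n es ->
  strictly_below (bset n ds) (bset n es) =
  all (fun e => all (fun d => e.1 < d.1) ds) es.
Proof.
move=> gd ge; rewrite -(forall_bset (fun r _ => all (fun d => r < d.1) ds) ge).
apply: eq_forallb => x; congr (_ ==> _).
exact: (forall_bset (fun r _ => x.1 < r) gd).
Qed.

(** After a positive letter the first row is strictly longer, so a negative letter gives a
    horizontal domino in the second row, strictly below. After any other letter it is not strictly
    below, since its predecessor reaches the second row or lower. *)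
Lemma domino_Des_tab (u : word) : valid_word u ->
  domino_Des (tab (size u) u) = [set i : 'I_(size u) | desw u i].
Proof.
move=> vu; apply/setP=> i; rewrite !inE /desw.
case: i => [[|i] isz] /=.
  rewrite (_ : [exists j, _] = false) ?orbF; last first.
    by apply/existsP=> -[].
  rewrite andbT ffunE /= take0 /=.
  have V := valid_word_None vu isz; have gr := cells_in_grid vu isz.
  rewrite take0 in V gr; case E : (nth None u 0) V gr => [[]|] //= V gr.
  - apply: (contraTF _ isT) => vert.
    by have := is_vertical_bset (gr : in_grid _ [:: (0, 0); (0, 1)]) vert.
  - by apply/verticalP; exists 0, 0; split=> //; exact: gr.
  by have := V erefl.
set j := Ordinal (ltnW isz).
have -> : [exists k : 'I_(size u), (k.+1 == i.+1) &&
    strictly_below (tab (size u) u (Ordinal isz)) (tab (size u) u k)] =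
    strictly_below (tab (size u) u (Ordinal isz)) (tab (size u) u j).
  apply/existsP/idP => [[k /andP[/eqP [ki]]]|H]; last by exists j; rewrite eqxx.
  by rewrite (_ : k = j) //; apply: val_inj.
rewrite !ffunE strictly_below_bset ?cells_in_grid ?(ltnW isz) //=.
(* After a first [None], a second one would be a descent for [desw] but not for the tableau. *)
have NN : nth None u i = None -> nth None u i.+1 <> None.
  move=> ni /(valid_word_None vu isz)/andP[+ _].
  by rewrite (take_nth None) ?(ltnW isz) // ni mem_rcons mem_head.
have [le10 _ _ _ _] := rows_inv (take i u).
rewrite rows_take ?(ltnW isz) //.
case: (rows _) le10 => [[r0 r1] r2] /= le10.
case: (nth None u i) NN => [[]|]; case: (nth None u i.+1) => [[]|] NN //=.
- by have -> : (r0.+2 == r1) = false by lia.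
- by case: eqP.
- by case: eqP => e; rewrite /cells ?e ?eqxx //=; case: eqP.
- by case: eqP.
- by case: eqP.
by have := NN erefl erefl.
Qed.

(** * Valid words give standard tableaux *)

Lemma rows_part (u : word) (i : nat) : valid_word u ->
  (rows (take i u)).2 <= (rows (take i u)).1.2 <= (rows (take i u)).1.1.
Proof.
move=> /andP[/eqP c1 lt]; have [-> _ _ -> pos] := rows_inv (take i u).
rewrite andbT; have le1 : count_mem None (take i u) <= 1.
  by rewrite -c1 -[in X in _ <= X](cat_take_drop i u) count_cat leq_addr.
case: (posnP (count_mem None (take i u))) => [-> //|].
rewrite -has_count has_pred1 => nt; apply: leq_trans le1 _; rewrite pos.
have nu : None \in u by rewrite (mem_take nt).
have fu : Some false \in u by rewrite -index_mem (leq_trans lt) // index_size.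
rewrite in_take // in nt; rewrite in_take //; exact: ltn_trans lt nt.
Qed.

Lemma young_mono (u : word) (n i j : nat) : i <= j ->
  young_diagram n (shape4 (rows (take i u)))
    \subset young_diagram n (shape4 (rows (take j u))).
Proof.
elim: j => [|j IH]; first by rewrite leqn0 => /eqP->.
rewrite leq_eqVlt => /orP[/eqP->//|]; rewrite ltnS => /IH sub.
apply: subset_trans sub _; case: (ltnP j (size u)) => juz.
  by rewrite rows_take // young_step subsetUl.
by rewrite !take_oversize // ltnW.
Qed.

Lemma tab_sub_young (n : nat) (u : word) (i : 'I_n) (j : nat) : size u = n ->
  i < j -> tab n u i \subset young_diagram n (shape4 (rows (take j u))).
Proof.
move=> szu ij; apply: subset_trans (young_mono u n ij).
by rewrite rows_take ?szu // young_step ffunE subsetUr.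
Qed.

Lemma cover_tab (n : nat) (u : word) : size u = n ->
  \bigcup_i tab n u i = young_diagram n (shape4 (rows u)).
Proof.
move=> szu; apply/eqP; rewrite eqEsubset; apply/andP; split.
  apply/bigcupsP=> i _; have := tab_sub_young szu (ltn_ord i).
  by rewrite take_oversize ?szu.
have E : take n u = u by rewrite take_oversize ?szu.
rewrite -{1}E.
suff : forall k, k <= n -> young_diagram n (shape4 (rows (take k u)))
    \subset \bigcup_i tab n u i by apply.
elim=> [_|k IH kn].
  apply/subsetP=> x; rewrite take0 in_young /=.
  by case: (nat_of_ord x.1) => [|[|[|[|?]]]] //=; rewrite nth_nil.
rewrite rows_take ?szu // young_step subUset IH ?(ltnW kn) //=.
have := @bigcup_sup _ _ (Ordinal kn) predT (tab n u) isT.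
by rewrite ffunE.
Qed.

Lemma tab_domino (u : word) (i : 'I_(size u)) : valid_word u ->
  is_horizontal (tab (size u) u i) || is_vertical (tab (size u) u i).
Proof.
move=> vu; rewrite ffunE; have := cells_in_grid vu (ltn_ord i).
case: (rows _) => [[r0 r1] r2]; case: (nth None u i) => [[]|] /=.
- by move=> gr; apply/orP; left; apply/horizontalP; exists 0, r0.
- case: eqP => _ gr; apply/orP.
    by right; apply/verticalP; exists 0, r0.
  by left; apply/horizontalP; exists 1, r1.
by move=> gr; apply/orP; right; apply/verticalP; exists 2, r2.
Qed.

Lemma young_closed (n : nat) (s : nat * nat * nat) (x y : box n) :
  s.2 <= s.1.2 <= s.1.1 -> val x.1 <= val y.1 -> val x.2 <= val y.2 ->
  y \in young_diagram n (shape4 s) -> x \in young_diagram n (shape4 s).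
Proof.
rewrite !in_young; case: x y s => [[i hi] [j ?]] [[k hk] [l ?]] [[r0 r1] r2] /=.
by case: i hi => [|[|[|[|i]]]] _; case: k hk => [|[|[|[|k]]]] _ /=; rewrite ?nth_nil; lia.
Qed.

(** Each prefix fills a partition shape. A box left of or above a box of an earlier domino lies in
    the shape already filled, from which a later domino is disjoint; so labels increase. *)
Lemma tab_standard (n : nat) (u : word) : size u = n -> valid_word u ->
  tab n u \in standard_domino_tableaux n (shape4 (rows u)).
Proof.
move=> szu vu; rewrite inE /is_domino_tiling (cover_tab szu) eqxx andbT.
have disj (i j : 'I_n) : i < j -> [disjoint tab n u i & tab n u j].
  move=> ij; apply: disjointWl (tab_sub_young szu ij) _.
  by rewrite disjoint_sym ffunE cells_disjoint.
apply/andP; split; first apply/andP; first split.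
- by apply/forallP=> i; subst n; apply: tab_domino.
- apply/forallP=> i; apply/forallP=> j; apply/implyP=> ne.
  have : (i < j) || (j < i) by rewrite -neq_ltn.
  by case/orP=> /disj; rewrite // disjoint_sym.
apply/forallP=> i; apply/forallP=> j; apply/forall_inP=> x xi.
apply/forall_inP=> y yj; apply/implyP=> /andP[ne H].
rewrite ltnNge; apply/negP=> ji.
have {}ji : j < i by rewrite ltn_neqAle ji andbT eq_sym.
have yi := subsetP (tab_sub_young szu ji) _ yj.
have xyi : x \in young_diagram n (shape4 (rows (take i u))).
  have [le1 le2] : x.1 <= y.1 /\ x.2 <= y.2.
    by case/orP: H => /andP[/eqP-> /ltnW].
  exact: young_closed (rows_part i vu) le1 le2 yi.
move: xi; rewrite ffunE => xi.
by have := disjointFr (cells_disjoint n _ _) xi; rewrite xyi.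
Qed.

Lemma tab_in_shapes (n : nat) (u : word) : size u = n -> valid_word u ->
  ~~ no_later false u ->
  tab n u \in \bigcup_(a < n.*2 | 2 <= n.*2 - a - 2 <= a)
            standard_domino_tableaux n [:: val a; n.*2 - a - 2; 1; 1].
Proof.
move=> szu vu nl; have [le10 _ sz r2 _] := rows_inv u.
have c1 : count_mem None u = 1 by case/andP: vu => /eqP.
have r1 := rows1_gt1 vu; rewrite nl in r1.
have := tab_standard szu vu; rewrite /shape4 r2 c1.
rewrite c1 szu in sz; have hr : (rows u).1.1 < n.*2 by lia.
have e : (rows u).1.2 = n.*2 - (rows u).1.1 - 2 by lia.
move=> H; apply/bigcupP; exists (Ordinal hr); rewrite /= -e //.
by rewrite r1.
Qed.

(** * Standard tableaux come from valid words *)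

(** Here [ds] is the next domino and [s] the shape filled so far. The closure hypothesis is tested
    on the first free box of a row: a domino further to the right would require that box to be
    filled. The last hypothesis excludes a domino across rows two and three. *)
Lemma next_cells (a b : nat) (s : nat * nat * nat) (ds : seq (nat * nat)) :
  (exists r c, ds = [:: (r, c); (r, c.+1)] \/ ds = [:: (r, c); (r.+1, c)]) ->
  (forall r c, (r, c) \in ds -> c < nth 0 [:: a; b; 1; 1] r) ->
  (forall r c, (r, c) \in ds -> nth 0 (shape4 s) r <= c) ->
  (forall r c r' c', (r', c') \in ds ->
     ((r == r') && (c < c')) || ((c == c') && (r < r')) ->
     (c < nth 0 (shape4 s) r) || ((r, c) \in ds)) ->
  (forall c, (2, c) \in ds -> (3, c) \in ds) ->
  exists2 l, ds = cells s l & l = None -> s.2 = 0 /\ 0 < s.1.2.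
Proof.
case: s => [[r0 r1] r2] [r [c H]] sub dis cl v23; rewrite /shape4 /= in dis cl *.
have rc : (r, c) \in ds by case: H => ->; rewrite mem_head.
case: H => E.
  have rc' : (r, c.+1) \in ds by rewrite E !inE eqxx orbT.
  have := sub _ _ rc'; have := dis _ _ rc.
  case: r E rc rc' => [|[|[|[|r]]]] //= E rc rc' le lt; last by rewrite nth_nil in lt.
    have := cl 0 r0 0 c rc; rewrite E !inE !xpair_eqE /= => cl0.
    have ec : c = r0 by lia.
    by exists (Some true) => //; rewrite ec.
  have := cl 1 r1 1 c rc; rewrite E !inE !xpair_eqE /= => cl0.
  (* The box above the right end is filled, so the first row is longer and [cells] takes its
     horizontal branch. *)
  have := cl 0 c.+1 1 c.+1 rc'; rewrite E !inE !xpair_eqE /= eqxx => /(_ isT) cl1.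
  have ec : c = r1 by lia.
  exists (Some false) => //; rewrite ec /cells; case: eqP => //; lia.
have rc' : (r.+1, c) \in ds by rewrite E !inE eqxx orbT.
have := sub _ _ rc'; have := dis _ _ rc; have := dis _ _ rc'.
case: r E rc rc' => [|[|[|[|r]]]] //= E rc rc' le' le lt.
- have := cl 0 r0 0 c rc; rewrite E !inE !xpair_eqE /= => cl0.
  have := cl 1 r1 1 c rc'; rewrite E !inE !xpair_eqE /= => cl1.
  have e0 : r0 = c by lia.
  have e1 : r1 = c by lia.
  by exists (Some false) => //; rewrite e0 e1 /cells eqxx.
- by have := v23 _ rc'; rewrite E !inE !xpair_eqE.
- have c0 : c = 0 by lia.
  have rc0 : (2, 0) \in ds by move: rc; rewrite c0.
  have := cl 1 0 2 0 rc0 isT; rewrite E !inE !xpair_eqE /= => cl1.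
  exists None; last by move=> _ /=; lia.
  by rewrite c0 /cells; have -> : r2 = 0 by lia.
Qed.

Lemma size_tab_word (n : nat) (T : {ffun 'I_n -> {set box n}}) :
  size (tab_word T) = n.
Proof. by rewrite size_map size_enum_ord. Qed.

Lemma nth_tab_word (n : nat) (T : {ffun 'I_n -> {set box n}}) (i : 'I_n) :
  nth None (tab_word T) i = domino_letter (T i).
Proof. by rewrite (nth_map i) ?size_enum_ord // nth_ord_enum. Qed.

(** Increasing labels put every box left of or above a box of [T i] in [T i] itself or in an earlier
    domino, which is the closure required by [next_cells]. *)
Lemma standard_step (n a b : nat) (T : {ffun 'I_n -> {set box n}}) (i : 'I_n)
    (s : nat * nat * nat) : b <= a -> 0 < b ->
  T \in standard_domino_tableaux n [:: a; b; 1; 1] ->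
  (forall x, (x \in young_diagram n (shape4 s)) =
     [exists j : 'I_n, (j < i) && (x \in T j)]) ->
  let c := domino_letter (T i) in
  [/\ T i = bset n (cells s c), in_grid n (cells s c)
    & c = None -> s.2 = 0 /\ 0 < s.1.2].
Proof.
move=> ba b0; rewrite inE => /andP[/and3P[/forallP dom /forallP dis /eqP cov] /forallP lab] U.
have disj j k x : x \in T j -> x \in T k -> j = k.
  move=> xj xk; apply/eqP; apply: contraT => ne.
  by have /implyP/(_ ne)/disjointFr/(_ xj) := forallP (dis j) k; rewrite xk.
have inT x : x \in young_diagram n [:: a; b; 1; 1] -> exists j, x \in T j.
  by rewrite -cov => /bigcupP[j _]; exists j.
have Tin j x : x \in T j -> val x.2 < nth 0 [:: a; b; 1; 1] (val x.1).
  by move=> xj; rewrite -in_young -cov; apply/bigcupP; exists j.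
have [ds [gr E adj]] : exists ds, [/\ in_grid n ds, T i = bset n ds &
    exists r c, ds = [:: (r, c); (r, c.+1)] \/ ds = [:: (r, c); (r.+1, c)]].
  case/orP: (dom i) => [/horizontalP|/verticalP] [r [c [gr E]]].
    by exists [:: (r, c); (r, c.+1)]; split=> //; exists r, c; left.
  by exists [:: (r, c); (r.+1, c)]; split=> //; exists r, c; right.
have gr' r c : (r, c) \in ds -> (r < n.*2) && (c < n.*2).
  by move=> /(allP gr).
have [] := @next_cells a b s ds adj.
- move=> r c dd; have /andP[hr hc] := gr' _ _ dd.
  by apply: (@Tin i (Ordinal hr, Ordinal hc)); rewrite E in_bset.
- move=> r c dd; have /andP[hr hc] := gr' _ _ dd.
  rewrite leqNgt; apply/negP => lt.
  have : (Ordinal hr, Ordinal hc) \in young_diagram n (shape4 s) by rewrite in_young.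
  rewrite U => /existsP[j /andP[ji xj]].
  have xi : (Ordinal hr, Ordinal hc) \in T i by rewrite E in_bset.
  by rewrite (disj _ _ _ xj xi) ltnn in ji.
- move=> r c r' c' dd H; have /andP[hr' hc'] := gr' _ _ dd.
  have hr : r < n.*2 by lia.
  have hc : c < n.*2 by lia.
  pose x : box n := (Ordinal hr, Ordinal hc).
  pose y : box n := (Ordinal hr', Ordinal hc').
  have yi : y \in T i by rewrite E in_bset.
  have [j xj] : exists j, x \in T j.
    apply: inT; rewrite in_young /=; have /= := Tin _ _ yi.
    case: (r) (r') H => [|[|[|[|?]]]] [|[|[|[|?]]]] /=; rewrite ?nth_nil; lia.
  have [ji|ne] := eqVneq j i.
    by apply/orP; right; rewrite -(in_bset (n := n) ds x) -E -ji.
  have ji : j < i.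
    have /forall_inP/(_ x xj)/forall_inP/(_ y yi)/implyP := forallP (lab j) i.
    by apply; rewrite ne.
  apply/orP; left; rewrite -(in_young (n := n) (shape4 s) x) U.
  by apply/existsP; exists j; rewrite ji.
- move=> c dd; have /andP[hr hc] := gr' _ _ dd.
  pose x : box n := (Ordinal hr, Ordinal hc).
  have xi : x \in T i by rewrite E in_bset.
  (* From [2 < n.*2] by parity. *)
  have hr' : 3 < n.*2 by lia.
  pose y : box n := (Ordinal hr', Ordinal hc).
  have [j yj] : exists j, y \in T j.
    by apply: inT; have := Tin _ _ xi; rewrite in_young.
  suff xj : x \in T j by rewrite -(in_bset (n := n) ds y) -E (disj _ _ _ xi xj).
  have /= c1 := Tin _ _ xi.
  have sub z : z \in T j -> val z.2 < nth 0 [:: a; b; 1; 1] (val z.1) by apply: Tin.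
  (* The domino covering the box in row four is not horizontal, as that row has one box, and cannot
     reach a fifth row; so it also covers the box above. *)
  case/orP: (dom j) => [/horizontalP|/verticalP] [p [q [/and3P[/andP[g1 g2] /andP[g3 g4] _] F]]].
    have := sub (Ordinal g3, Ordinal g4); rewrite F in_bset !inE eqxx orbT => /(_ isT) /=.
    move: yj; rewrite F in_bset !inE !xpair_eqE /=.
    by case: (p) => [|[|[|[|?]]]] //=; lia.
  have := sub (Ordinal g3, Ordinal g4); rewrite F in_bset !inE eqxx orbT => /(_ isT) /=.
  move: yj; rewrite F in_bset !inE !xpair_eqE /=.
  by case: (p) => [|[|[|[|?]]]] //=; rewrite ?nth_nil; lia.
move=> l El Hl; have gl : in_grid n (cells s l) by rewrite -El.
by rewrite E El domino_letter_cells.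
Qed.

Lemma standard_tab (n a b : nat) (T : {ffun 'I_n -> {set box n}}) :
  1 < b <= a -> a < n.*2 ->
  T \in standard_domino_tableaux n [:: a; b; 1; 1] ->
  [/\ T = tab n (tab_word T), valid_word (tab_word T)
    & ~~ no_later false (tab_word T)].
Proof.
move=> /andP[b1 ba] an TS; set u := tab_word T.
have szu : size u = n := size_tab_word T.
have U k : k <= n -> forall x,
    (x \in young_diagram n (shape4 (rows (take k u)))) =
    [exists j : 'I_n, (j < k) && (x \in T j)].
  elim: k => [_ x|k IH kn x].
    rewrite take0 in_young /= (_ : _ < _ = false).
      by apply/esym/existsP=> -[].
    by case: (nat_of_ord x.1) => [|[|[|[|?]]]] //=; rewrite nth_nil.
  have [E _ _] := @standard_step n a b T (Ordinal kn) _ ba (ltnW b1) TS (IH (ltnW kn)).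
  rewrite rows_take ?szu // young_step in_setU IH ?(ltnW kn) //.
  have := nth_tab_word T (Ordinal kn); rewrite -/u /= => ->; rewrite -E.
  apply/orP/existsP => [[/existsP[j /andP[jk xj]]|xk]|[j /andP[jk xj]]].
  - by exists j; rewrite xj ltnS ltnW.
  - by exists (Ordinal kn); rewrite /= ltnSn.
  - move: jk; rewrite ltnS leq_eqVlt => /orP[/eqP jk|jk].
      by right; rewrite (_ : Ordinal kn = j) //; apply: val_inj.
    by left; apply/existsP; exists j; rewrite jk.
have S (i : 'I_n) := @standard_step n a b T i _ ba (ltnW b1) TS (U i (ltnW (ltn_ord i))).
have TE : T = tab n u.
  by apply/ffunP=> i; rewrite ffunE nth_tab_word; have [] := S i.
have cov : young_diagram n (shape4 (rows u)) = young_diagram n [:: a; b; 1; 1].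
  rewrite -(cover_tab szu) -TE.
  by move: TS; rewrite inE => /andP[/and3P[_ _ /eqP->]].
(* The final shape is probed at single boxes: (2, 0) shows that [None] occurs, and (1, 1) that the
   second row exceeds one box. *)
have mem r c (hr : r < n.*2) (hc : c < n.*2) :
    (c < nth 0 (shape4 (rows u)) r) = (c < nth 0 [:: a; b; 1; 1] r).
  have := in_young (shape4 (rows u)) ((Ordinal hr, Ordinal hc) : box n).
  by rewrite cov in_young.
have vu : valid_word u.
  apply: valid_wordI => [|i].
    have [_ _ _ r2 _] := rows_inv u.
    by have := mem 2 0 ltac:(lia) ltac:(lia); rewrite /= r2 -has_count has_pred1.
  rewrite szu => isz ui; have [_ _] := S (Ordinal isz).
  rewrite -nth_tab_word /= -/u => /(_ ui) [].
  have [_ _ _ -> ->] := rows_inv (take i u).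
  by move/count_memPn => -> ->.
split=> //; rewrite -rows1_gt1 //.
by have := mem 1 1 ltac:(lia) ltac:(lia); rewrite /= b1.
Qed.

(** * Permutations *)

Lemma mask_all_pred (A : eqType) (a : pred A) (m : bitseq) (w : seq A) :
  size m = size w -> all a (mask m w) -> all (predC a) (mask (map negb m) w) ->
  m = map a w.
Proof.
elim: w m => [|x w IH] [|[] m] //= [sz].
  by case/andP=> -> am nm; rewrite -(IH _ sz am nm).
by move=> am /andP[/negbTE -> nm]; rewrite -(IH _ sz am nm).
Qed.

(** Since [a] tells the two sequences apart, the mask can only be [map a w]. *)
Lemma shuffle_filter (A : eqType) (a : pred A) (s t w : seq A) :
  all a s -> all (predC a) t ->
  is_shuffle s t w = (filter a w == s) && (filter (predC a) w == t).
Proof.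
move=> sa ta; apply/existsP/andP => [[m /andP[/eqP ms /eqP mt]]|[/eqP fs /eqP ft]].
  have E : m = map a w :> bitseq.
    by apply: mask_all_pred; rewrite ?size_tuple ?ms ?mt.
  by rewrite !filter_mask -ms -mt E -map_comp.
have sz : size (map a w) == size w by rewrite size_map.
exists (Tuple sz); rewrite /= -map_comp -(filter_mask a) fs eqxx.
by rewrite -(filter_mask (predC a)) ft /=.
Qed.

Lemma eq_from_filter (A : eqType) (a : pred A) (v w : seq A) :
  map a v = map a w -> filter a v = filter a w ->
  filter (predC a) v = filter (predC a) w -> v = w.
Proof.
elim: v w => [|x v IH] [|y w] //= [->].
case: (a y) => /= E fa fb.
  by case: fa => -> fa; rewrite (IH w).
by case: fb => -> fb; rewrite (IH w).
Qed.

Lemma exists_merge (A : eqType) (a : pred A) (m : bitseq) (s t : seq A) :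
  all a s -> all (predC a) t -> count id m = size s -> count negb m = size t ->
  exists w, [/\ map a w = m, filter a w = s & filter (predC a) w = t].
Proof.
elim: m s t => [|[] m IH] s t sa ta /=.
- by case: s sa => // _; case: t ta => // _ _ _; exists nil.
- case: s sa => // x s /= /andP[ax sa]; rewrite add1n add0n => -[cs] ct.
  have [w [mw fw gw]] := IH s t sa ta cs ct.
  by exists (x :: w); rewrite /= ax mw fw gw.
case: t ta => // x t /= /andP[ax ta]; rewrite add1n add0n => cs [ct].
have [w [mw fw gw]] := IH s t sa ta cs ct.
by exists (x :: w); rewrite /= ax (negbTE ax) mw fw gw.
Qed.

Lemma index_filter_lt (A : eqType) (a : pred A) (x y : A) (w : seq A) :
  a x -> a y ->
  (index x (filter a w) < index y (filter a w)) = (index x w < index y w).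
Proof.
move=> ax ay; elim: w => //= z w IH; case: ifP => az /=.
  by case: (z =P x) => [->|zx]; case: (_ =P y) => // zy; rewrite ltnS.
have [zx zy] : z != x /\ z != y.
  by split; apply: contraFneq az => ->.
by rewrite (negbTE zx) (negbTE zy) ltnS.
Qed.

Lemma map_const_in (A B : eqType) (f : A -> B) (b : B) (s : seq A) :
  {in s, forall x, f x = b} -> map f s = nseq (size s) b.
Proof.
move=> H; have -> : map f s = map (fun=> b) s by apply/eq_in_map.
by elim: s {H} => //= x s ->.
Qed.

(** * Words of type 4 permutations *)

Definition letter (n : nat) (x : int) : option bool :=
  if x == (- n%:Z)%R then None else Some (0 < x)%R.

Definition perm_word (n : nat) (p : {perm 'I_(n.*2.+1)}) : word :=
  map (letter n) (sword p).

Definition is_neg (x : int) : bool := (x < 0)%R.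

Lemma letter_neg (n : nat) (x : int) : 0 < n ->
  (letter n x != Some true) = is_neg x || (x == 0)%R.
Proof.
rewrite /letter /is_neg => n0; case: (x =P _) => [->|_]; first by rewrite /=; lia.
by rewrite (inj_eq Some_inj) eqb_id; lia.
Qed.

Lemma neg_letters_all (n k l : nat) : 0 < k -> all is_neg (neg_letters n k l).
Proof.
move=> k0; apply/allP=> x /mapP[i]; rewrite mem_cat !mem_rev !mem_iota => H ->.
rewrite /is_neg; lia.
Qed.

Lemma pos_letters_all (k l : nat) : all (predC is_neg) (pos_letters k l).
Proof. by apply/allP=> x /mapP[i]; rewrite mem_iota /is_neg => H -> /=; lia. Qed.

Lemma type4P (n : nat) (p : {perm 'I_(n.*2.+1)}) :
  reflect (exists k l, [/\ 0 < k, k < l, l < n, p \in hyperoctahedral n &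
             filter is_neg (sword p) = neg_letters n k l /\
             filter (predC is_neg) (sword p) = pos_letters k l])
          (p \in type4_signed_arc n).
Proof.
apply: (iffP bigcupP) => [[l _ /bigcupP[k k0]]|[k [l [k0 kl ln pB [fn fp]]]]].
  rewrite inE (shuffle_filter _ (neg_letters_all _ _ k0) (pos_letters_all _ _)).
  by case/and3P=> pB /eqP fn /eqP fp; exists k, l; split.
exists (Ordinal ln) => //; apply/bigcupP; exists (Ordinal kl) => //=.
rewrite inE pB (shuffle_filter _ (neg_letters_all _ _ k0) (pos_letters_all _ _)).
by rewrite fn fp !eqxx.
Qed.

Lemma letter_neg_letters (n k l : nat) : k <= l -> l < n ->
  map (letter n) (neg_letters n k l) =
  nseq k (Some false) ++ None :: nseq (n - l.+1) (Some false).
Proof.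
move=> kl ln; rewrite /neg_letters map_cat map_cat.
have -> : n - l = (n - l.+1) + 1 by lia.
rewrite iotaD rev_cat /= (_ : (l.+1 + (n - l.+1))%N = n); last by lia.
have E i : 0 < i < n -> letter n (- i%:Z)%R = Some false.
  by move=> H; rewrite /letter; case: eqP => [|_]; [lia|congr Some; lia].
rewrite -!map_comp /= {2}/letter eqxx; congr (_ ++ _ :: _).
  rewrite (map_const_in (b := Some false)) ?size_rev ?size_iota // => i.
  by rewrite mem_rev mem_iota => H; apply: E; lia.
rewrite (map_const_in (b := Some false)) ?size_rev ?size_iota // => i.
by rewrite mem_rev mem_iota => H; apply: E; lia.
Qed.

Lemma letter_pos_letters (n k l : nat) : 0 < n ->
  map (letter n) (pos_letters k l) = nseq (l - k) (Some true).
Proof.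
move=> n0; rewrite (map_const_in (b := Some true)) ?size_map ?size_iota // => x.
move=> /mapP[i]; rewrite mem_iota => H ->.
by rewrite /letter; case: eqP => [|_]; [lia|congr Some; lia].
Qed.

(** For [0 < n], [letter] gives 0 the negative sign while [is_neg] rejects it; without 0 the two
    ways of splitting [w] agree. *)
Lemma sword_neq0 (n k l : nat) (w : seq int) : 0 < k -> 
  filter is_neg w = neg_letters n k l ->
  filter (predC is_neg) w = pos_letters k l -> 0%R \notin w.
Proof.
move=> k0 fn fp; apply/negP=> w0.
have : 0%R \in filter (predC is_neg) w by rewrite mem_filter /= w0.
by rewrite fp => /mapP[i]; rewrite mem_iota; lia.
Qed.

Lemma filter_perm_word (n k l : nat) (w : seq int) : 0 < k -> k <= l -> l < n ->
  filter is_neg w = neg_letters n k l ->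
  filter (predC is_neg) w = pos_letters k l ->
  [/\ map (predC1 (Some true)) (map (letter n) w) = map is_neg w,
      filter (predC1 (Some true)) (map (letter n) w) =
        nseq k (Some false) ++ None :: nseq (n - l.+1) (Some false)
    & filter (predC (predC1 (Some true))) (map (letter n) w) =
        nseq (l - k) (Some true)].
Proof.
move=> k0 kl ln fn fp; have w0 := sword_neq0 k0 fn fp.
have n0 : 0 < n by lia.
have E : {in w, preim (letter n) (predC1 (Some true)) =1 is_neg}.
  move=> x xw /=; rewrite letter_neg //; case: eqP => [x0|_]; rewrite ?orbF //.
  by rewrite -x0 xw in w0.
rewrite !filter_map -map_comp (eq_in_filter E) fn letter_neg_letters //.
rewrite (eq_in_filter (a2 := predC is_neg)); last by move=> x xw; rewrite /= -E.
by rewrite fp letter_pos_letters //; split=> //; apply/eq_in_map.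
Qed.

Lemma sword_valid (n k l : nat) (w : seq int) : 0 < k -> k < l -> l < n ->
  filter is_neg w = neg_letters n k l ->
  filter (predC is_neg) w = pos_letters k l ->
  valid_word (map (letter n) w) /\ ~~ no_later true (map (letter n) w).
Proof.
move=> k0 kl ln fn fp.
have [_ F G] := filter_perm_word k0 (ltnW kl) ln fn fp.
set u := map _ _ in F G *.
have vu : valid_word u.
  apply/andP; split.
    rewrite -(@eq_count _ (predI (pred1 None) (predC1 (Some true)))); last by case=> [[]|].
    by rewrite -count_filter F count_cat /= !count_nseq.
  rewrite -(index_filter_lt (a := predC1 (Some true))) // F.
  by case: k k0 {kl fn fp F G}.
split=> //; rewrite -has_plus //.
have : Some true \in filter (predC (predC1 (Some true))) u.
  by rewrite G mem_nseq eqxx andbT subn_gt0.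
by rewrite mem_filter => /andP[].
Qed.

Lemma size_neg_letters (n k l : nat) : size (neg_letters n k l) = k + (n - l).
Proof. by rewrite size_map size_cat !size_rev !size_iota. Qed.

(** The negative letters before and after -n are counted by the word, which recovers [k] and then
    [l]; the letters are then prescribed. *)
Lemma sword_inj (n k l k' l' : nat) (v w : seq int) :
  0 < k -> k < l -> l < n -> 0 < k' -> k' < l' -> l' < n ->
  filter is_neg v = neg_letters n k l ->
  filter (predC is_neg) v = pos_letters k l ->
  filter is_neg w = neg_letters n k' l' ->
  filter (predC is_neg) w = pos_letters k' l' ->
  map (letter n) v = map (letter n) w -> v = w.
Proof.
move=> k0 kl ln k0' kl' ln' fv gv fw gw E.
have [mv F _] := filter_perm_word k0 (ltnW kl) ln fv gv.
have [mw F' _] := filter_perm_word k0' (ltnW kl') ln' fw gw.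
have idx (m j : nat) :
    index None (nseq m (Some false) ++ None :: nseq j (Some false)) = m.
  by elim: m => //= m ->.
have ek : k = k' by rewrite -(idx k (n - l.+1)) -F E F' idx.
have el : n - l.+1 = n - l'.+1.
  by move: F'; rewrite -E F ek => /(congr1 size); rewrite !size_cat /= !size_nseq; lia.
have {}el : l = l' by lia.
apply: (@eq_from_filter _ is_neg); first by rewrite -mv -mw E.
  by rewrite fv fw ek el.
by rewrite gv gw ek el.
Qed.

(** Take for [k] the place of [None] among the letters that are not positive, and for [l - k] the
    number of positive letters; then merge the two prescribed sequences along the sign pattern of
    [u]. *)
Lemma exists_sword (u : word) : valid_word u -> ~~ no_later true u ->
  exists k l w, [/\ 0 < k, k < l, l < size u, map (letter (size u)) w = u
    & filter is_neg w = neg_letters (size u) k l /\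
       filter (predC is_neg) w = pos_letters k l].
Proof.
move=> vu nl; set n := size u; set F := filter (predC1 (Some true)) u.
have /andP[/eqP cu iu] := vu.
have iF : index (Some false) F < index None F by rewrite index_filter_lt.
have cF : count_mem None F = 1.
  rewrite count_filter -cu; apply: eq_count; by case=> [[]|].
have nF : index None F < size F by rewrite index_mem -has_pred1 has_count cF.
pose k := index None F; pose j := size F - k.+1.
have EF : F = nseq k (Some false) ++ None :: nseq j (Some false).
  have E : F = take k F ++ None :: drop k.+1 F.
    by rewrite -{1}(cat_take_drop k F) (drop_nth None nF) nth_index // -index_mem.
  have nt : None \notin take k F by rewrite in_take_leq ?ltnn // ltnW.
  have nd : None \notin drop k.+1 F.
    apply/count_memPn; move: cF; rewrite {1}E count_cat /= (count_memPn nt); lia.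
  have sf x : x \in F -> x != None -> x = Some false.
    by rewrite mem_filter /= => /andP[]; case: x => [[]|].
  rewrite {1}E; congr (_ ++ _ :: _).
    transitivity (nseq (size (take k F)) (Some false)); last by rewrite size_takel // ltnW.
    apply/all_pred1P/allP=> x xt; apply/eqP/sf; first exact: mem_take xt.
    by apply: contraNneq nt => <-.
  rewrite /j -size_drop.
  apply/all_pred1P/allP=> x xt; apply/eqP/sf; first exact: mem_drop xt.
  by apply: contraNneq nd => <-.
have k0 : 0 < k by apply: leq_trans iF.
pose m := count_mem (Some true) u.
have m0 : 0 < m by rewrite -has_count has_pred1 has_plus.
have sz : n = m + (k + j.+1).
  rewrite /n -(count_predC (pred1 (Some true))); congr (_ + _).
  have -> : count (predC (pred1 (Some true))) u = size F by rewrite size_filter.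
  by rewrite EF size_cat /= !size_nseq.
pose l := k + m.
have kl : k < l by rewrite /l; lia.
have ln : l < n by rewrite /l; lia.
have [w [mw fw gw]] := @exists_merge _ is_neg (map (predC1 (Some true)) u)
  (neg_letters n k l) (pos_letters k l) (neg_letters_all n l k0) (pos_letters_all k l)
  ltac:(rewrite size_neg_letters count_map -size_filter -/F EF size_cat /= !size_nseq; lia)
  ltac:(rewrite size_map size_iota count_map /l addKn;
        apply: eq_count => x /=; rewrite negbK //).
exists k, l, w; split=> //.
have [mw' Fw Gw] := filter_perm_word k0 (ltnW kl) ln fw gw.
apply: (@eq_from_filter _ (predC1 (Some true))); first by rewrite mw' mw.
  by rewrite Fw -/F EF; congr (_ ++ _ :: nseq _ _); lia.
rewrite Gw /l addKn.
have -> : filter (predC (predC1 (Some true))) u = filter (pred1 (Some true)) u.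
  by apply: eq_filter => x /=; rewrite negbK.
by rewrite /m -size_filter; apply/esym/all_pred1P/filter_all.
Qed.

(** Up to order, the absolute values form the consecutive blocks 1 to k, k+1 to l, and l+1 to n. *)
Lemma abs_letters (n k l : nat) (w : seq int) : k <= l -> l <= n ->
  filter is_neg w = neg_letters n k l ->
  filter (predC is_neg) w = pos_letters k l ->
  perm_eq (map absz w) (iota 1 n).
Proof.
move=> kl ln fn fp.
apply: (perm_trans (y := map absz (neg_letters n k l ++ pos_letters k l))).
  by apply: perm_map; rewrite -fn -fp perm_sym (permEl (perm_filterC is_neg w)).
rewrite map_cat /neg_letters /pos_letters -!map_comp.
rewrite (eq_map (g := id)); last by move=> i /=; lia.
rewrite [X in _ ++ X](eq_map (g := id)); last by move=> i /=; lia.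
rewrite !map_id -catA.
have -> : iota 1 n = iota 1 k ++ iota k.+1 (l - k) ++ iota l.+1 (n - l).
  rewrite -(add1n k) -(add1n l) -{2}(subnKC kl) addnA -!iotaD; congr (iota _ _).
  by lia.
by rewrite perm_cat ?perm_rev // perm_catC perm_cat2l perm_rev.
Qed.

(** * Signed permutations and their words *)

Lemma rev_ordE (n : nat) (x : 'I_(n.*2.+1)) : rev_ord x = n.*2 - x :> nat.
Proof. by rewrite /= subSS. Qed.

Lemma hyperoctahedralP (n : nat) (p : {perm 'I_(n.*2.+1)}) :
  p \in hyperoctahedral n -> forall x, p (rev_ord x) = rev_ord (p x).
Proof. by rewrite inE => /forallP pB x; apply/eqP. Qed.

Lemma inord_mid (n : nat) : (inord n : 'I_(n.*2.+1)) = n :> nat.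
Proof. by rewrite inordK // ltnS -addnn leq_addr. Qed.

Lemma hyperoctahedral_mid (n : nat) (p : {perm 'I_(n.*2.+1)}) :
  p \in hyperoctahedral n -> p (inord n) = n :> nat.
Proof.
move=> /hyperoctahedralP/(_ (inord n)).
have -> : rev_ord (inord n : 'I_(n.*2.+1)) = inord n.
  by apply: ord_inj; rewrite rev_ordE inord_mid; lia.
move/(congr1 val); rewrite /= => E; have := ltn_ord (p (inord n)); lia.
Qed.

Lemma nth_sword (n : nat) (p : {perm 'I_(n.*2.+1)}) (i : nat) : i < n ->
  nth 0%R (sword p) i = sval_at p i.+1.
Proof. by move=> hi; rewrite (nth_map 0) ?size_iota // nth_iota. Qed.

Lemma size_sword (n : nat) (p : {perm 'I_(n.*2.+1)}) : size (sword p) = n.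
Proof. by rewrite size_map size_iota. Qed.

Lemma hyperoctahedral_inj (n : nat) (p q : {perm 'I_(n.*2.+1)}) :
  p \in hyperoctahedral n -> q \in hyperoctahedral n -> sword p = sword q ->
  p = q.
Proof.
move=> pB qB E.
have pos (x : 'I_(n.*2.+1)) : n < x -> p x = q x.
  move=> nx; have hi : (x - n).-1 < n by have := ltn_ord x; lia.
  have := nth_sword p hi; rewrite E nth_sword // /sval_at.
  have -> : inord (n + (x - n).-1.+1) = x.
    by apply: ord_inj; rewrite inordK; have := ltn_ord x; lia.
  by move=> H; apply: ord_inj; lia.
apply/permP=> x; case: (ltngtP n x) => nx; first exact: pos.
  have := pos (rev_ord x); rewrite !hyperoctahedralP // rev_ordE => H.
  by apply/rev_ord_inj/H; lia.
have -> : x = inord n by apply: ord_inj; rewrite inord_mid.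
by apply: ord_inj; rewrite !hyperoctahedral_mid.
Qed.

Lemma sword_onto (n : nat) (w : seq int) : perm_eq (map absz w) (iota 1 n) ->
  exists2 p, p \in hyperoctahedral n & sword p = w.
Proof.
move=> pw; have szw : size w = n.
  by have := perm_size pw; rewrite size_map size_iota.
have unw : uniq (map absz w) by rewrite (perm_uniq pw) iota_uniq.
have bw i : i < n -> 0 < absz (nth 0%R w i) <= n.
  move=> hi; have : absz (nth 0%R w i) \in iota 1 n.
    by rewrite -(perm_mem pw) map_f // mem_nth ?szw.
  by rewrite mem_iota; lia.
have iw i j : i < n -> j < n -> absz (nth 0%R w i) = absz (nth 0%R w j) -> i = j.
  move=> hi hj E; apply/eqP; rewrite -(nth_uniq 0%N _ _ unw) ?size_map ?szw //.
  by rewrite !(nth_map 0%R) ?szw // E.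
have opp i j : i < n -> j < n -> nth 0%R w i <> (- nth 0%R w j)%R.
  move=> hi hj E; have := bw _ hj; have := iw _ _ hi hj.
  rewrite E abszN => /(_ erefl) ij; rewrite ij in E; lia.
have nz i : i < n -> nth 0%R w i <> 0%R.
  by move=> hi E; have := bw _ hi; rewrite E.
(* The odd extension of the word: [h x] is the value at the integer [x - n]. The predecessors appear
   because [w] is indexed from 0. *)
pose h (x : nat) : int := if x <= n then
    if x < n then (- nth 0%R w (n - x).-1)%R else 0%R
  else nth 0%R w (x - n).-1.
have hb x : x <= n.*2 -> absz (h x) <= n.
  move=> hx; rewrite /h; case: (ltngtP x n) => xn //; rewrite ?abszN.
    have hi : (n - x).-1 < n by lia.
    by have /andP[] := bw _ hi.
  have hi : (x - n).-1 < n by lia.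
  by have /andP[] := bw _ hi.
pose g (x : 'I_(n.*2.+1)) : 'I_(n.*2.+1) := inord (absz (h x + n%:Z)%R).
have gE x : Posz (g x) = (h x + n%:Z)%R.
  by have := hb x (ltn_ord x) => hx; rewrite /g inordK; lia.
have g_inj : injective g.
  move=> x y /(congr1 (fun z : 'I__ => Posz z)); rewrite !gE => E.
  have {}E : h x = h y by lia.
  have hx := ltn_ord x; have hy := ltn_ord y.
  apply: ord_inj; move: E; rewrite /h.
  case: (ltngtP x n) => xn; case: (ltngtP y n) => yn.
  - move/oppr_inj/(congr1 absz) => E.
    have : (n - x).-1 = (n - y).-1 by apply: iw E; lia.
    by lia.
  - by move/esym => E; case: (opp _ _ _ _ E); lia.
  - by move/eqP; rewrite oppr_eq0 => /eqP E; case: (nz _ _ E); lia.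
  - by move=> E; case: (opp _ _ _ _ E); lia.
  - move/(congr1 absz) => E.
    have : (x - n).-1 = (y - n).-1 by apply: iw E; lia.
    by lia.
  - by move=> E; case: (nz _ _ E); lia.
  - by move/esym/eqP; rewrite oppr_eq0 => /eqP E; case: (nz _ _ E); lia.
  - by move/esym => E; case: (nz _ _ E); lia.
  by move=> _; rewrite xn yn.
have hN x : x <= n.*2 -> h (n.*2 - x) = (- h x)%R.
  move=> hx; rewrite /h; case: (ltngtP x n) => xn.
  - have -> : (n.*2 - x <= n) = false by lia.
    by rewrite opprK; congr nth; lia.
  - have -> : n.*2 - x <= n by lia.
    have -> : n.*2 - x < n by lia.
    by congr (- nth _ _ _)%R; lia.
  have -> : n.*2 - x <= n by lia.
  by have -> : (n.*2 - x < n) = false by lia.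
exists (perm g_inj).
  rewrite inE; apply/forallP=> x; apply/eqP/ord_inj; rewrite !permE rev_ordE.
  have := gE (rev_ord x); rewrite rev_ordE hN; last by rewrite -ltnS ltn_ord.
  by have := gE x; have := ltn_ord (g x); lia.
apply: (@eq_from_nth _ 0%R) => [|i]; rewrite size_sword ?szw // => hi.
rewrite nth_sword // /sval_at permE gE inordK; last by lia.
rewrite addrK /h; have -> : (n + i.+1 <= n) = false by lia.
by congr nth; lia.
Qed.

(** * Descents of type 4 permutations *)

(** Only adjacent entries are compared: the sequence increases except for its drop to -n. *)
Lemma sorted_neg_letters (n k l : nat) : k <= l -> l < n ->
  sorted (fun a b => (b == - n%:Z)%R || (a < b)%R) (neg_letters n k l).
Proof.
move=> kl ln; have nthE i : i < k + (n - l) -> nth 0%R (neg_letters n k l) i =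
    if i < k then (- (k - i)%:Z)%R else (- (n - (i - k))%:Z)%R.
  move=> hi; rewrite (nth_map 0); last by rewrite size_cat !size_rev !size_iota.
  rewrite nth_cat size_rev size_iota; case: ltnP => ik; congr (- (Posz _))%R.
    by rewrite nth_rev ?size_iota // nth_iota; lia.
  by rewrite nth_rev ?size_iota ?nth_iota; lia.
apply/(sortedP 0%R) => i; rewrite size_neg_letters => hi.
by rewrite !nthE //; case: (ltnP i k) => ?; case: (ltnP i.+1 k) => ?; lia.
Qed.

Lemma sorted_pos_letters (k l : nat) :
  sorted (fun a b => (a < b)%R) (pos_letters k l).
Proof.
rewrite sorted_map; apply: sub_sorted (iota_ltn_sorted _ _) => i j; lia.
Qed.

(** Neighbours in [w] that both satisfy [a] remain neighbours in [filter a w]. *)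
Lemma sorted_filter_nth (A : eqType) (a : pred A) (r : rel A) (x0 : A)
    (w : seq A) (i : nat) : sorted r (filter a w) -> i.+1 < size w ->
  a (nth x0 w i) -> a (nth x0 w i.+1) -> r (nth x0 w i) (nth x0 w i.+1).
Proof.
move=> sr hi ai ai1; move: sr; rewrite -{1}(cat_take_drop i w).
rewrite (drop_nth x0) ?(ltnW hi) // (drop_nth x0) //.
rewrite filter_cat /= ai ai1 => /cat_sorted2[_] /=.
by case/andP.
Qed.

(** Signs decide between letters of different sign. Neighbours of equal sign ascend by the
    sortedness lemmas, unless the second is -n, the least possible value, where there is always a
    descent. *)
Lemma sperm_Des_word (n : nat) (p : {perm 'I_(n.*2.+1)}) :
  p \in type4_signed_arc n ->
  sperm_Des p = [set i : 'I_n | desw (perm_word p) i].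
Proof.
move=> /type4P[k [l [k0 kl ln pB [fn fp]]]]; apply/setP=> -[i hi]; rewrite !inE /=.
have w0 := sword_neq0 k0 fn fp; have n0 : 0 < n by lia.
have nw j : j < n -> nth None (perm_word p) j = letter n (sval_at p j.+1).
  by move=> hj; rewrite (nth_map 0%R) ?size_sword // nth_sword.
have nz j : j < n -> sval_at p j.+1 <> 0%R.
  by move=> hj E; move: w0; rewrite -E -nth_sword // mem_nth ?size_sword.
have pw := abs_letters (ltnW kl) (ltnW ln) fn fp.
have un : uniq (map absz (sword p)) by rewrite (perm_uniq pw) iota_uniq.
have bd j : j < n -> absz (sval_at p j.+1) <= n.
  move=> hj; have : absz (sval_at p j.+1) \in iota 1 n.
    by rewrite -(perm_mem pw) map_f // -nth_sword // mem_nth ?size_sword.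
  by rewrite mem_iota; lia.
have ne j : j.+1 < n -> absz (sval_at p j.+1) <> absz (sval_at p j.+2).
  move=> hj E; have nm m : m < n ->
      nth 0 (map absz (sword p)) m = absz (sval_at p m.+1).
    by move=> hm; rewrite -nth_sword // (nth_map 0%R) ?size_sword.
  have : nth 0 (map absz (sword p)) j == nth 0 (map absz (sword p)) j.+1.
    by rewrite !nm ?(ltnW hj) // E.
  by rewrite nth_uniq ?size_map ?size_iota ?(ltnW hj) //; lia.
case: i hi => [|i] hi /=.
  rewrite /desw nw //= andbT.
  have -> : sval_at p 0 = 0%R by rewrite /sval_at addn0 hyperoctahedral_mid //; lia.
  rewrite /letter; case: (sval_at p 1 =P _) => [->|ne1]; first by rewrite /=; lia.
  by have := nz 0 hi; rewrite /= (inj_eq Some_inj); lia.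
rewrite /desw !nw // ?(ltnW hi) //=.
have S1 := @sorted_filter_nth _ is_neg _ 0%R (sword p) i
  (eq_ind_r (sorted _) (sorted_neg_letters (ltnW kl) ln) fn).
have S2 := @sorted_filter_nth _ (predC is_neg) _ 0%R (sword p) i
  (eq_ind_r (sorted _) (sorted_pos_letters k l) fp).
rewrite size_sword !nth_sword ?(ltnW hi) // in S1 S2.
have := ne _ hi; have := bd _ hi; have := bd _ (ltnW hi).
have := nz _ hi; have := nz _ (ltnW hi).
move: S1 S2; rewrite /letter /is_neg /= => /(_ hi) + /(_ hi).
move: (sval_at p i.+1) (sval_at p i.+2) => x y.
case: (y =P _) => [->|ny]; case: (x =P _) => [->|nx]; rewrite /= ?(inj_eq Some_inj).
- by lia.
- by lia.
- by rewrite (_ : (None == Some true) = false) // andbF; lia.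
by lia.
Qed.

(** * The bijection *)

Theorem proposition9 (n : nat) (hn : 1 <= n) :
  exists f : {perm 'I_(n.*2.+1)} -> {ffun 'I_n -> {set box n}},
    [/\ {in type4_signed_arc n &, injective f},
        [set f p | p in type4_signed_arc n] =
          \bigcup_(a < n.*2 | 2 <= n.*2 - a - 2 <= a)
            standard_domino_tableaux n [:: val a; n.*2 - a - 2; 1; 1]
      & {in type4_signed_arc n,
          forall p, domino_Des (f p) = sperm_Des p}].
Proof.
have szp (p : {perm 'I_(n.*2.+1)}) : size (perm_word p) = n.
  by rewrite size_map size_sword.
have vp p : p \in type4_signed_arc n ->
    valid_word (perm_word p) /\ ~~ no_later true (perm_word p).
  by move=> /type4P[k [l [k0 kl ln _ [fn fp]]]]; apply: sword_valid fn fp.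
have ve p : p \in type4_signed_arc n -> valid_word (exchange (perm_word p)).
  by move=> /vp[vp' _]; apply: valid_exchange.
exists (fun p => tab n (exchange (perm_word p))); split.
- move=> p q p4 q4 E.
  have {}E : perm_word p = perm_word q.
    apply: (can_inj exchangeK).
    have := tab_wordK (ve _ p4); have := tab_wordK (ve _ q4).
    by rewrite !size_exchange !szp E => -> ->.
  have /type4P[k [l [k0 kl ln pB [fn fp]]]] := p4.
  have /type4P[k' [l' [k0' kl' ln' qB [fn' fp']]]] := q4.
  apply: hyperoctahedral_inj => //.
  exact: (sword_inj k0 kl ln k0' kl' ln' fn fp fn' fp' E).
- apply/setP=> T; apply/imsetP/idP => [[p p4 ->]|/bigcupP[a /andP[b1 ba] TS]].
    have [vu nl] := vp _ p4.
    apply: tab_in_shapes; rewrite ?size_exchange ?szp ?ve //.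
    exact: exchange_no_later nl.
  have [TE vu nl] := standard_tab (introT andP (conj b1 ba)) (ltn_ord a) TS.
  set u := tab_word T in TE vu nl.
  (* As [exchange] is an involution, the preimage of [T] is the permutation with word
     [exchange u]. *)
  have [k [l [w [k0 kl ln lw [fn fp]]]]] :=
    exists_sword (valid_exchange vu) (exchange_no_later nl).
  rewrite size_exchange size_tab_word in ln lw fn fp.
  have [p pB pw] := sword_onto (abs_letters (ltnW kl) (ltnW ln) fn fp).
  exists p; last by rewrite /perm_word pw lw exchangeK.
  by apply/type4P; exists k, l; rewrite pw.
move=> p p4; rewrite sperm_Des_word //.
have := domino_Des_tab (ve _ p4); rewrite size_exchange szp => ->.
by apply/setP=> i; rewrite !inE desw_exchange ?szp.
Qed.
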